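(* Let $\mathcal{C}$ be a $[km,k,m]_{q^m/q}$ simplex rank-metric code. Then $\mathcal{C}$ is minimal.
   Context: Let $q$ be a prime power, $m\ge 1$ and $k\ge2$ integers. For $v\in\mathbb{F}_{q^m}^n$ and an ordered basis $\Gamma=(\gamma_1,\dots,\gamma_m)$ of $\mathbb{F}_{q^m}$ over $\mathbb{F}_q$, let $\Gamma(v)\in\mathbb{F}_q^{n\times m}$ be the matrix with $v_i=\sum_{j}\Gamma(v)_{ij}\gamma_j$. The rank support $\sigma^{\mathrm{rk}}(v)\subseteq\mathbb{F}_q^n$ is the column space of $\Gamma(v)$ (independent of $\Gamma$), and $\mathrm{rk}(v)=\dim_{\mathbb{F}_q}\sigma^{\mathrm{rk}}(v)$. An $[n,k,d]_{q^m/q}$ code is a $k$-dimensional $\mathbb{F}_{q^m}$-subspace of $\mathbb{F}_{q^m}^n$ whose nonzero codewords have minimum rank $d$; $d$ is omitted when irrelevant. A code is nondegenerate if $\sum_{v\in\mathcal{C}}\sigma^{\mathrm{rk}}(v)=\mathbb{F}_q^n$. A simplex rank-metric code is a nondegenerate $[km,k]_{q^m/q}$ code with $k\ge2$; equivalently, a $[km,k]_{q^m/q}$ code such that the $\mathbb{F}_q$-span of the columns of a generator matrix is all of $\mathbb{F}_{q^m}^k$ (all of its nonzero codewords then have rank $m$). A code $\mathcal{C}$ is minimal if for all $v,v'\in\mathcal{C}$, $\sigma^{\mathrm{rk}}(v')\subseteq\sigma^{\mathrm{rk}}(v)$ implies $v'=\alpha v$ for some $\alpha\in\mathbb{F}_{q^m}$.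 *)

(* Defs.v *)
From HB Require Import structures.
From mathcomp Require Import all_boot all_order all_algebra all_field.

Set Implicit Arguments.
Unset Strict Implicit.
Unset Printing Implicit Defensive.

Import GRing.Theory.
Local Open Scope ring_scope.

(* F plays the role of F_q and L that of F_{q^m}, with m = \dim {:L}. *)

Section RankMetric.

Variables (F : finFieldType) (L : fieldExtType F) (n : nat).

Implicit Types (v : 'rV[L]_n) (C : {vspace 'rV[L]_n}).

Definition expand_mx m (Gamma : m.-tuple L) v : 'M[F]_(n, m) :=
  \matrix_(i < n, j < m) coord Gamma j (v 0 i).

Definition col_space m (A : 'M[F]_(n, m)) : {vspace 'cV[F]_n} :=
  <<[seq col j A | j : 'I_m]>>%VS.

(* The choice of the basis [vbasis {:L}] is immaterial: see [rank_suppE]. *)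
Definition rank_supp v : {vspace 'cV[F]_n} :=
  col_space (expand_mx (vbasis {:L}) v).

Definition rk v : nat := \dim (rank_supp v).

Lemma expand_mxE m (Gamma : m.-tuple L) v i :
  basis_of {:L} Gamma -> v 0 i = \sum_(j < m) expand_mx Gamma v i j *: Gamma`_j.
Proof.
move=> bG; rewrite [LHS](coord_basis bG) ?memvf //.
by apply: eq_bigr => j _; rewrite mxE.
Qed.

Lemma col_space_sub m m' (Gamma : m.-tuple L) (Gamma' : m'.-tuple L) v :
  basis_of {:L} Gamma ->
  (col_space (expand_mx Gamma' v) <= col_space (expand_mx Gamma v))%VS.
Proof.
move=> bG; apply/span_subvP => _ /mapP[j _ ->].
have ->: col j (expand_mx Gamma' v) =
    \sum_(l < m) coord Gamma' j Gamma`_l *: col l (expand_mx Gamma v).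
  apply/colP => i; rewrite !mxE (expand_mxE v i bG) linear_sum summxE.
  by apply: eq_bigr => l _; rewrite linearZ !mxE mulrC.
apply: memv_suml => l _; apply/memvZ/memv_span.
by apply/mapP; exists l; rewrite ?mem_enum.
Qed.

Lemma rank_suppE m (Gamma : m.-tuple L) v :
  basis_of {:L} Gamma -> rank_supp v = col_space (expand_mx Gamma v).
Proof.
move=> bG; apply: subv_anti; rewrite /rank_supp.
by rewrite !col_space_sub ?vbasisP.
Qed.

Definition min_rank C (d : nat) : Prop :=
  (exists v, [/\ v \in C, v != 0 & rk v = d]) /\
  (forall v, v \in C -> v != 0 -> (d <= rk v)%N).

Definition code C (k d : nat) : Prop := \dim C = k /\ min_rank C d.

(* [finvect_type L] is [L] with its structure of finite field, so that the
   sum below ranges over the finitely many codewords. *)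
Definition nondegenerate C : Prop :=
  (\sum_(v : 'rV[finvect_type L]_n | (v : 'rV[L]_n) \in C)
     rank_supp (v : 'rV[L]_n))%VS = {: 'cV[F]_n}%VS.

Lemma nondegenerateP C :
  nondegenerate C <->
  forall U : {vspace 'cV[F]_n},
    (forall v, v \in C -> (rank_supp v <= U)%VS) -> U = fullv.
Proof.
split=> [ndC U sCU | h].
  apply: subv_anti; rewrite subvf -ndC.
  by apply/subv_sumP => v /sCU.
apply: h => v vC.
exact: (@sumv_sup _ _ _ (v : 'rV[finvect_type L]_n)).
Qed.

Definition simplex C (k : nat) : Prop :=
  [/\ (2 <= k)%N, n = (k * \dim {:L})%N, \dim C = k & nondegenerate C].

Definition minimal_code C : Prop :=
  forall v v', v \in C -> v' \in C ->
    (rank_supp v' <= rank_supp v)%VS -> exists alpha : L, v' = alpha *: v.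

End RankMetric.

(* Main.v *)
(* Each u in F^n gives the L-linear form x |-> sum_i u_i x_i on C. It vanishes
   at x iff u is orthogonal to the rank support of x, so nondegeneracy makes
   F^n -> Hom_L(C, L) injective; as both sides have #|F| ^ (k * m) elements, it
   is bijective. If v' is not a multiple of v, some linear form kills v but not
   v'; the u representing it is orthogonal to the support of v but not to that
   of v'. *)
Require Import Defs.
From mathcomp Require Import all_boot all_order all_algebra all_field.

Import GRing.Theory.
Local Open Scope ring_scope.

Definition pairing {F : finFieldType} {L : fieldExtType F} {n : nat}
    (u : 'cV[F]_n) (x : 'rV[L]_n) : L :=
  \sum_(i < n) u i 0 *: x 0 i.

Lemma pairingBl (F : finFieldType) (L : fieldExtType F) (n : nat)
    (u w : 'cV[F]_n) (x : 'rV[L]_n) :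
  pairing (u - w) x = pairing u x - pairing w x.
Proof.
by rewrite -sumrB; apply: eq_bigr => i _; rewrite !mxE scalerBl.
Qed.

Lemma pairing_sumZr (F : finFieldType) (L : fieldExtType F) (n k : nat)
    (u : 'cV[F]_n) (a : 'I_k -> L) (b : 'I_k -> 'rV[L]_n) :
  pairing u (\sum_j a j *: b j) = \sum_j a j * pairing u (b j).
Proof.
rewrite /pairing; under eq_bigr => i _ do rewrite summxE scaler_sumr.
rewrite exchange_big; apply: eq_bigr => j _ /=.
by rewrite mulr_sumr; apply: eq_bigr => i _; rewrite mxE scalerAr.
Qed.

(** The hyperplane orthogonal to [u] (everything if [u] is 0), built as a kernel so that it is a
    [vspace] comparable with rank supports. *)
Definition orthogonal_col {F : finFieldType} {n : nat} (u : 'cV[F]_n) :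
    {vspace 'cV[F]_n} :=
  lker (linfun (mulmx u^T : 'cV[F]_n -> 'cV[F]_1)).

Lemma mem_orthogonal_col (F : finFieldType) (n : nat) (u x : 'cV[F]_n) :
  (x \in orthogonal_col u) = (\sum_i u i 0 * x i 0 == 0).
Proof.
rewrite memv_ker lfunE /=; apply/eqP/eqP => [/matrixP/(_ 0 0) | ux0].
  by rewrite !mxE => ux0; rewrite -[RHS]ux0; apply: eq_bigr => i _; rewrite mxE.
apply/matrixP => i j; rewrite !ord1 !mxE -[RHS]ux0.
by apply: eq_bigr => l _; rewrite mxE.
Qed.

(** Since [coord] is [F]-linear, the coordinates of [pairing u x] in the basis of [L] are the dot
    products of [u] with the columns that span [rank_supp x]. *)
Lemma pairing_eq0 (F : finFieldType) (L : fieldExtType F) (n : nat)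
    (u : 'cV[F]_n) (x : 'rV[L]_n) :
  (pairing u x == 0) = (rank_supp x <= orthogonal_col u)%VS.
Proof.
have coordE j : \sum_i u i 0 * col j (expand_mx (vbasis {:L}) x) i 0
    = coord (vbasis {:L}) j (pairing u x).
  by rewrite linear_sum; apply: eq_bigr => i _; rewrite linearZ !mxE.
apply/eqP/span_subvP => [ux0 _ /mapP[j _ ->] | sxu].
  by rewrite mem_orthogonal_col coordE ux0 linear0.
rewrite (coord_vbasis (memvf (pairing u x))) big1 // => j _.
apply/eqP; rewrite -coordE scaler_eq0 -mem_orthogonal_col sxu //.
by apply/mapP; exists j; rewrite ?mem_enum.
Qed.

Lemma orthogonal_col_full (F : finFieldType) (n : nat) (u : 'cV[F]_n) :
  orthogonal_col u = fullv -> u = 0.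
Proof.
move=> fu; apply/colP => i; rewrite mxE.
have: delta_mx i 0 \in orthogonal_col u by rewrite fu memvf.
rewrite mem_orthogonal_col (bigD1 i) //= mxE !eqxx mulr1 big1 ?addr0 => [/eqP //|].
by move=> l /negPf nli; rewrite mxE nli mulr0.
Qed.

Lemma simplex_pairing_surj (F : finFieldType) (L : fieldExtType F) (n k : nat)
    (C : {vspace 'rV[L]_n}) (g : 'rV[L]_n -> L) :
    linear_for *%R g -> simplex C k ->
  exists u : 'cV[F]_n, forall x, x \in C -> pairing u x = g x.
Proof.
move=> gL [_ nE dC /nondegenerateP ndC].
have gD x y : g (x + y) = g x + g y by rewrite -[x]scale1r gL mul1r scale1r.
have g0 : g 0 = 0 by apply: (addrI (g 0)); rewrite -gD !addr0.
have gZ a x : g (a *: x) = a * g x by rewrite -[a *: x]addr0 gL g0 addr0.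
pose b := vbasis C.
have gE x : x \in C -> g x = \sum_j coord b j x * g b`_j.
  move=> xC; rewrite {1}(coord_vbasis xC) (big_morph g gD g0).
  by apply: eq_bigr => j _; rewrite gZ.
have pE u x : x \in C -> pairing u x = \sum_j coord b j x * pairing u b`_j.
  by move=> xC; rewrite {1}(coord_vbasis xC) pairing_sumZr.
(* By [gE] and [pE], a form on [C] amounts to its values on [b]; [finvect_type] makes these rows
   countable. *)
pose Phi (u : 'cV[F]_n) : 'rV[finvect_type L]_(\dim C) :=
  \row_j (pairing u b`_j : finvect_type L).
have Phi_inj : injective Phi.
  (* Here [u - w] pairs to 0 with all of [C], so its orthogonal contains every rank support and is
     full by nondegeneracy. *)
  move=> u w /rowP eq_uw; apply/subr0_eq/orthogonal_col_full/ndC => x xC.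
  rewrite -pairing_eq0 pE // big1 // => j _.
  by have := eq_uw j; rewrite !mxE pairingBl => ->; rewrite subrr mulr0.
have cardPhi : #|{: 'rV[finvect_type L]_(\dim C)}| = #|{: 'cV[F]_n}|.
  have cardL : #|finvect_type L| = (#|F| ^ \dim {:L})%N.
    rewrite -(card_vspace (fullv : {vspace finvect_type L})).
    by apply: eq_card => x; rewrite memvf.
  by rewrite !card_mx cardL mul1n muln1 -expnM dC mulnC -nE.
pose lam : 'rV[finvect_type L]_(\dim C) := \row_j (g b`_j : finvect_type L).
have /codomP[u uE] : lam \in codom Phi.
  by apply: inj_card_onto => //; rewrite cardPhi.
exists u => x xC; rewrite pE // gE //; apply: eq_bigr => j _.
by move/rowP/(_ j): uE; rewrite !mxE => ->.
Qed.

(** Removing the projection onto the line of [v] is a linear map with exactly that line as kernel; a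
    nonzero coordinate of the image of [w] selects the form. *)
Lemma separating_form (K : fieldType) (n : nat) (v w : 'rV[K]_n) :
    w \notin <[v]>%VS ->
  exists g : 'rV[K]_n -> K, [/\ linear_for *%R g, g v = 0 & g w != 0].
Proof.
move=> wNv; pose p x := x - projv <[v]>%VS x.
have /rV0Pn[i pwi] : p w != 0.
  apply: contraNneq wNv => /subr0_eq ->; exact: memv_proj.
exists (fun x => p x 0 i); split=> // [a x y|].
  by rewrite /p linearP opprD addrACA -scalerBr !mxE.
by rewrite /p projv_id ?memv_line // subrr mxE.
Qed.

Theorem theorem6p1 (F : finFieldType) (L : fieldExtType F) (m k : nat)
    (hm : \dim {:L} = m) (C : {vspace 'rV[L]_(k * m)})
    (hC : code C k m) (hS : simplex C k) :
  minimal_code C.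
Proof.
(* Being a multiple of [v] is membership in [<[v]>], so the argument goes by contradiction. *)
move=> v v' vC v'C sv'v; apply/vlineP/negPn/negP => /separating_form[g [gL gv gv']].
have [u uE] := simplex_pairing_surj _ _ _ _ _ _ gL hS.
case/negP: gv'; rewrite -uE // pairing_eq0 (subv_trans sv'v) //.
by rewrite -pairing_eq0 uE // gv.
Qed.
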